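(* Let $T>0$, let $\alpha\in C([0,T];(\tfrac13,1))$ satisfy $\sup_{t\in[0,T];\,|h|\le1}|h|^{\alpha(t)-\alpha(t+h)}<\infty$, and let $X\in\mathcal C^{\alpha(\cdot)}([0,T];\mathbb R^d)$. Consider a partition $\mathcal P=\{[\rho_0,\rho_1],\dots,[\rho_{N-1},\rho_N]\}$ of $[0,T]$, and assume that on each square $[\rho_i,\rho_{i+1}]^2$ there is an object $\mathbb X^{|[\rho_i,\rho_{i+1}]}:[\rho_i,\rho_{i+1}]^2\to\mathbb R^{d\times d}$ satisfying locally the Chen relation $$\mathbb X^{|[\rho_i,\rho_{i+1}]}_{s,t}-\mathbb X^{|[\rho_i,\rho_{i+1}]}_{s,u}-\mathbb X^{|[\rho_i,\rho_{i+1}]}_{u,t}=X_{s,u}X_{u,t}\qquad(\rho_i\le s\le u\le t\le\rho_{i+1})$$ and the analytic requirement $\|\mathbb X^{|[\rho_i,\rho_{i+1}]}\|_{2\alpha(\cdot)\wedge1;[\rho_i,\rho_{i+1}]}<\infty$. Then there exists an object $\mathbb X:[0,T]^2\to\mathbb R^{d\times d}$ such that $$(\delta\mathbb X)_{s,u,t}=X_{s,u}X_{u,t}\quad(0\le s\le u\le t\le T)\qquad\text{and}\qquad\|\mathbb X\|_{2\alpha(\cdot)\wedge1;[0,T]}<\infty,$$ and hence $(X,\mathbb X)\in\mathscr C^{\alpha(\cdot)}([0,T];\mathbb R^d)$.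
   Context: Suprema over $h$ are over $h\ne0$ with $t,t+h\in[0,T]$. Notation: $X_{s,t}=X_t-X_s$; $X_{s,u}X_{u,t}$ denotes the matrix (tensor product) $X_{s,u}\otimes X_{u,t}\in\mathbb R^{d\times d}$; for a two-variable function $g$, $(\delta g)_{s,u,t}=g_{s,t}-g_{s,u}-g_{u,t}$. $\mathcal C^{\alpha(\cdot)}([0,T];\mathbb R^d)$ is the space of $f:[0,T]\to\mathbb R^d$ with $\sup_{0\le t\le T;\,|h|\le1}|f(t+h)-f(t)|/|h|^{\alpha(t)}<\infty$. For a two-variable function $g$ on $[a,b]^2$, $$\|g\|_{2\alpha(\cdot)\wedge1;[a,b]}:=\sup_{a\le s<t\le b;\,|t-s|\le1}\frac{|g_{s,t}|}{|t-s|^{(2\alpha(s))\wedge1}} .$$ The space $\mathscr C^{\alpha(\cdot)}([0,T];\mathbb R^d)$ of variable order rough paths consists of pairs $(X,\mathbb X)$ with $X\in\mathcal C^{\alpha(\cdot)}([0,T];\mathbb R^d)$, $\mathbb X:[0,T]^2\to\mathbb R^{d\times d}$, $(\delta\mathbb X)_{s,u,t}=X_{s,u}X_{u,t}$ and $\|\mathbb X\|_{2\alpha(\cdot)\wedge1;[0,T]}<\infty$. *)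

(* Defs.v *)
From HB Require Import structures.
From mathcomp Require Import all_boot all_order all_algebra.
From mathcomp Require Import all_classical all_reals all_analysis.

Set Implicit Arguments.
Unset Strict Implicit.
Unset Printing Implicit Defensive.

Import Order.TTheory GRing.Theory Num.Theory.
Import numFieldNormedType.Exports.

Local Open Scope classical_set_scope.
Local Open Scope ring_scope.

(* A function on [0, T] (or on [a, b]^2) is
   represented by a total function on R (or on R * R, curried); every notion
   below only looks at its values on the intended domain.  `|x| on 'rV_d and
   `|A| on 'M_d is the library's maximum norm; which norm is chosen does not
   affect the finiteness of the seminorms below.  Seminorms are extended-real
   suprema. *)

Definition increment (R : realType) (d : nat) (X : R -> 'rV[R]_d) (s t : R) :
  'rV[R]_d := X t - X s.

(* Entry (i, j) is x_i * y_j. *)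
Definition tensor (R : realType) (d : nat) (x y : 'rV[R]_d) : 'M[R]_d :=
  x^T *m y.

Definition delta (R : realType) (d : nat) (g : R -> R -> 'M[R]_d)
  (s u t : R) : 'M[R]_d := g s t - g s u - g u t.

Definition chen (R : realType) (d : nat) (a b : R) (X : R -> 'rV[R]_d)
    (XX : R -> R -> 'M[R]_d) : Prop :=
  forall s u t, a <= s -> s <= u -> u <= t -> t <= b ->
    delta XX s u t = tensor (increment X s u) (increment X u t).

Definition exponent_oscillation (R : realType) (T : R) (alpha : R -> R) :
    \bar R :=
  ereal_sup [set y : \bar R | exists t h : R,
    [/\ 0 <= t <= T, 0 <= t + h <= T, h != 0, `|h| <= 1 &
        y = (`|h| `^ (alpha t - alpha (t + h)))%:E]].

Definition var_holder_seminorm (R : realType) (d : nat) (T : R)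
    (alpha : R -> R) (f : R -> 'rV[R]_d) : \bar R :=
  ereal_sup [set y : \bar R | exists t h : R,
    [/\ 0 <= t <= T, 0 <= t + h <= T, h != 0, `|h| <= 1 &
        y = (`|f (t + h) - f t| / `|h| `^ alpha t)%:E]].

Definition var_holder_space (R : realType) (d : nat) (T : R)
    (alpha : R -> R) : set (R -> 'rV[R]_d) :=
  [set f | (var_holder_seminorm T alpha f < +oo)%E].

Definition var_holder_norm2 (R : realType) (d : nat) (a b : R)
    (alpha : R -> R) (g : R -> R -> 'M[R]_d) : \bar R :=
  ereal_sup [set y : \bar R | exists s t : R,
    [/\ a <= s, s < t, t <= b, `|t - s| <= 1 &
        y = (`|g s t| / `|t - s| `^ Num.min (2 * alpha s) 1)%:E]].

Definition var_rough_path_space (R : realType) (d : nat) (T : R)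
    (alpha : R -> R) : set ((R -> 'rV[R]_d) * (R -> R -> 'M[R]_d)) :=
  [set p | [/\ var_holder_space T alpha p.1,
               chen 0 T p.1 p.2 &
               (var_holder_norm2 0 T alpha p.2 < +oo)%E]].

(* For [itv_partition a b s] the partition points are a :: s, with
   last point b. *)
Definition partition_point (R : realType) (a b : R) (s : seq R) (i : nat) : R :=
  nth b (a :: s) i.

(* Main.v *)
Require Import Defs.
From mathcomp Require Import all_boot all_order all_algebra.
From mathcomp Require Import all_classical all_reals all_analysis.
From mathcomp Require Import lra.
Import Order.TTheory GRing.Theory Num.Theory.
Import numFieldNormedType.Exports.
Set Implicit Arguments.
Unset Strict Implicit.
Unset Printing Implicit Defensive.
Local Open Scope classical_set_scope.
Local Open Scope ring_scope.

(* Chen's relation forces how two second-order processes on [a, m] and [m, b]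
   extend across m: XX_{s,t} = A_{s,m} + B_{m,t} + X_{s,m} X_{m,t} for
   s <= m <= t.  With D = t - s, the term B_{m,t} is of order
   D^(2 alpha(m) /\ 1), an exponent based at m rather than at s; since
   m - s <= D <= 1, the oscillation bound on (m - s)^(alpha(m) - alpha(s))
   turns it into a multiple of D^(2 alpha(s) /\ 1).  The interval [0, T] is
   then covered by gluing one partition cell at a time. *)

(** * Finite seminorms as pointwise bounds *)

Lemma ereal_sup_lt_pinftyP (R : realType) (S : set (\bar R)) :
  (ereal_sup S < +oo)%E <-> exists2 C : R, 0 <= C & ubound S C%:E.
Proof.
split=> [|[C _ SC]]; last first.
  by rewrite (le_lt_trans (ge_ereal_sup SC)) ?ltry.
have := @ereal_sup_ubound _ S.
case: (ereal_sup S) => [C||] SC // _.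
- exists (Num.max 0 C); first by rewrite le_max lexx.
  by move=> y /SC /le_trans; apply; rewrite lee_fin le_max lexx orbT.
(* A supremum equal to [-oo] covers the empty family, as for the seminorm over a degenerate
   interval; any nonnegative constant then works. *)
- by exists 0 => // y /SC; rewrite leeNy_eq => /eqP ->; rewrite leNye.
Qed.

Lemma var_holder_norm2_finiteP (R : realType) (d : nat) (a b : R)
    (alpha : R -> R) (g : R -> R -> 'M[R]_d) :
  (var_holder_norm2 a b alpha g < +oo)%E <->
  exists2 C : R, 0 <= C & forall s t, a <= s -> s < t -> t <= b ->
    t - s <= 1 -> `|g s t| <= C * (t - s) `^ Num.min (2 * alpha s) 1.
Proof.
rewrite /var_holder_norm2 ereal_sup_lt_pinftyP.
split=> -[C C0 gC]; exists C => //.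
- move=> s t as_ st tb ts; have ts0 : 0 < t - s by rewrite subr_gt0.
  rewrite -ler_pdivrMr ?powR_gt0// -lee_fin; apply: gC.
  by exists s, t; rewrite gtr0_norm.
- move=> _ [s [t [as_ st tb + ->]]]; have ts0 : 0 < t - s by rewrite subr_gt0.
  by rewrite gtr0_norm// lee_fin ler_pdivrMr ?powR_gt0// => ?; exact: gC.
Qed.

Lemma var_holder_space_bound (R : realType) (d : nat) (T : R)
    (alpha : R -> R) (X : R -> 'rV[R]_d) :
  var_holder_space T alpha X ->
  exists2 C : R, 0 <= C & forall s t, 0 <= s -> s < t -> t <= T ->
    t - s <= 1 -> `|increment X s t| <= C * (t - s) `^ alpha s.
Proof.
move=> /ereal_sup_lt_pinftyP[C C0 XC]; exists C => // s t s0 st tT ts.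
have ts0 : 0 < t - s by rewrite subr_gt0.
rewrite -ler_pdivrMr ?powR_gt0// -lee_fin; apply: XC.
exists s, (t - s); rewrite gtr0_norm// (addrC s) subrK gt_eqF//.
by split=> //; apply/andP; split=> //; lra.
Qed.

Lemma exponent_oscillation_bound (R : realType) (T : R) (alpha : R -> R) :
  (exponent_oscillation T alpha < +oo)%E ->
  exists M : R, forall s t, 0 <= s -> s < t -> t <= T -> t - s <= 1 ->
    (t - s) `^ (alpha t - alpha s) <= M.
Proof.
move=> /ereal_sup_lt_pinftyP[M _ oscM]; exists M => s t s0 st tT ts.
have st0 : 0 < t - s by rewrite subr_gt0.
(* The base point is the later time [t] and the step is backward, which gives the exponent
   [alpha t - alpha s] the sign needed to move from the gluing point back to [s]. *)
rewrite -lee_fin; apply: oscM; exists t, (s - t).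
rewrite (addrC t) subrK ltr0_norm ?opprB ?subr_eq0 ?lt_eqF//; last lra.
by split=> //; apply/andP; split=> //; lra.
Qed.

(** * Algebra of increments, tensors and Chen's relation *)

Lemma tensor_norm_le (R : realType) (d : nat) (x y : 'rV[R]_d) :
  `|tensor x y| <= `|x| * `|y|.
Proof.
have entry (z : 'rV[R]_d) i : `|z 0 i| <= `|z|.
  by rewrite [leRHS]/Num.norm /= mx_normrE; apply/bigmax_geP; right; exists (0, i).
rewrite [leLHS]/Num.norm /= mx_normrE; apply/bigmax_leP.
split=> [|[i j] _ /=]; first by rewrite mulr_ge0.
by rewrite /tensor mxE big_ord1 mxE normrM ler_pM.
Qed.

Lemma tensorDl (R : realType) (d : nat) (x y z : 'rV[R]_d) :
  tensor (x + y) z = tensor x z + tensor y z.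
Proof. by rewrite /tensor linearD mulmxDl. Qed.

Lemma tensorDr (R : realType) (d : nat) (x y z : 'rV[R]_d) :
  tensor x (y + z) = tensor x y + tensor x z.
Proof. by rewrite /tensor mulmxDr. Qed.

Lemma increment_split (R : realType) (d : nat) (X : R -> 'rV[R]_d)
    (s u t : R) : increment X s t = increment X s u + increment X u t.
Proof. by rewrite /increment [RHS]addrC addrA subrK. Qed.

Lemma tensor_increment_refl (R : realType) (d : nat) (X : R -> 'rV[R]_d)
    (s t u : R) :
  tensor (increment X s s) (increment X t u) = 0 /\
  tensor (increment X t u) (increment X s s) = 0.
Proof. by rewrite /tensor /increment subrr trmx0 mul0mx mulmx0. Qed.

Lemma chen_diag (R : realType) (d : nat) (a b : R) (X : R -> 'rV[R]_d)
    (XX : R -> R -> 'M[R]_d) (s : R) :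
  chen a b X XX -> a <= s <= b -> XX s s = 0.
Proof.
move=> XXc /andP[as_ sb]; have := XXc s s s as_ (lexx s) (lexx s) sb.
rewrite (tensor_increment_refl X s s s).1 /delta subrr sub0r.
by move/eqP; rewrite oppr_eq0 => /eqP.
Qed.

Lemma chenD (R : realType) (d : nat) (a b : R) (X : R -> 'rV[R]_d)
    (XX : R -> R -> 'M[R]_d) (s u t : R) :
  chen a b X XX -> a <= s -> s <= u -> u <= t -> t <= b ->
  XX s t = XX s u + XX u t + tensor (increment X s u) (increment X u t).
Proof.
move=> XXc as_ su ut tb; rewrite -(XXc s u t)// /delta.
by apply/matrixP => i j; rewrite !mxE; lra.
Qed.

(** * Gluing two processes across a common endpoint *)

Definition glue (R : realType) (d : nat) (X : R -> 'rV[R]_d) (m : R)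
    (A B : R -> R -> 'M[R]_d) (s t : R) : 'M[R]_d :=
  if t <= m then A s t else if m <= s then B s t else
  A s m + B m t + tensor (increment X s m) (increment X m t).

Section glue.
Variables (R : realType) (d : nat) (X : R -> 'rV[R]_d) (a m b : R).
Variables (A B : R -> R -> 'M[R]_d).
Hypotheses (am : a <= m) (mb : m <= b).
Hypotheses (Ac : chen a m X A) (Bc : chen m b X B).

(** The cases of [glue] overlap when [s = m] or [t = m]. There Chen's relation makes the diagonal
    value of [A] or [B] vanish and one increment is zero, so the three-term formula persists up to
    the boundary. *)
Lemma glue_across (s t : R) : s <= m -> m <= t ->
  glue X m A B s t =
  A s m + B m t + tensor (increment X s m) (increment X m t).
Proof.
move=> sm mt; rewrite /glue; case: leP => [tm|_].
  have -> : t = m by apply/eqP; rewrite eq_le tm.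
  rewrite (chen_diag Bc) ?lexx//.
  by rewrite (tensor_increment_refl X m s m).2 !addr0.
case: leP => // ms; have -> : s = m by apply/eqP; rewrite eq_le sm.
rewrite (chen_diag Ac) ?am ?lexx//.
by rewrite (tensor_increment_refl X m m t).1 add0r addr0.
Qed.

Lemma glue_right (s t : R) : m <= s -> s <= t ->
  glue X m A B s t = B s t.
Proof.
move=> ms st; rewrite /glue; case: leP => [tm|_]; last by rewrite ms.
have [-> ->] : s = m /\ t = m by split; lra.
by rewrite (chen_diag Ac) ?(chen_diag Bc) ?lexx ?am.
Qed.

Lemma glue_chen : chen a b X (glue X m A B).
Proof.
move=> s u t as_ su ut tb.
have [tm|/ltW mt] := leP t m.
  by rewrite /delta /glue tm (le_trans ut tm); exact: Ac.
have [ms|/ltW sm] := leP m s.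
  have [mu st] : m <= u /\ s <= t by rewrite (le_trans ms su) (le_trans su ut).
  by rewrite /delta !glue_right//; exact: Bc.
rewrite /delta (@glue_across s t)//.
(* The point [u] lies in one of the two halves. Chen's relation on that half splits its process at
   [u]; splitting the increments at [u] and [m] makes the remaining tensor terms match by
   bilinearity. *)
have [um|/ltW mu] := leP u m.
- rewrite (@glue_across u t)// {1}/glue um (@chenD _ _ _ _ _ _ s u m Ac)//.
  rewrite (increment_split X s u m) (increment_split X u m t).
  by rewrite tensorDl tensorDr; apply/matrixP => i j; rewrite !mxE; lra.
- rewrite (@glue_across s u)// glue_right// (@chenD _ _ _ _ _ _ m u t Bc)//.
  rewrite (increment_split X s m u) (increment_split X m u t).
  by rewrite tensorDl tensorDr; apply/matrixP => i j; rewrite !mxE; lra.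
Qed.
End glue.

(** Applied with [p] and [q] the values of [alpha] at [s] and [m], [v = m - s] and [D = t - s]. If
    [p <= q], the factor 1 suffices because [D <= 1]; otherwise the loss is at most [M ^+ 2]. The
    constant [1 + M ^+ 2] serves both cases. *)
Lemma powR_min_shift (R : realType) (p q v D M : R) :
  0 < v -> v <= D -> D <= 1 -> v `^ (q - p) <= M ->
  D `^ Num.min (2 * q) 1 <= (1 + M ^+ 2) * D `^ Num.min (2 * p) 1.
Proof.
move=> v0 vD D1 vM; have D0 : 0 < D by exact: lt_le_trans vD.
have D01 : 0 < D <= 1 by rewrite D0.
rewrite -[X in D `^ X <= _](subrK (Num.min (2 * p) 1)).
rewrite powRD ?(gt_eqF D0) ?implybT//; apply: ler_wpM2r; first exact: powR_ge0.
have [pq|qp] := leP p q.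
  rewrite (@le_trans _ _ 1) ?lerDl ?sqr_ge0//.
  rewrite -[leRHS](powRr0 D); apply: ger_powR => //.
  by rewrite subr_ge0 le_min !ge_min lexx orbT andbT ler_pM2l ?pq.
(* Truncation at 1 is 1-Lipschitz, so for [q < p] the difference of the two minima is at least
   [2 * (q - p)]. *)
apply: (@le_trans _ _ (D `^ (2 * (q - p)))).
  apply: ger_powR => //; rewrite lerBrDr.
  have : Num.min (2 * p) 1 <= 2 * p by rewrite ge_min lexx.
  have : Num.min (2 * p) 1 <= 1 by rewrite ge_min lexx orbT.
  by rewrite le_min => *; apply/andP; split; lra.
apply: (@le_trans _ _ (M ^+ 2)); last by rewrite lerDr.
rewrite mulrC powRrM powR_mulrn ?powR_ge0// lerXn2r ?nnegrE ?powR_ge0//.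
  by rewrite (le_trans _ vM) ?powR_ge0.
(* The exponent [q - p] is negative, so the power decreases in its base, and [v <= D] transfers the
   bound from [v] to [D]. *)
apply: le_trans vM; rewrite -opprB !powRN lef_pV2 ?posrE ?powR_gt0//.
by rewrite ge0_ler_powR ?nnegrE; lra.
Qed.

Lemma glue_norm (R : realType) (d : nat) (T : R) (alpha : R -> R)
    (X : R -> 'rV[R]_d) (a m b : R) (A B : R -> R -> 'M[R]_d) :
  (forall t, 0 <= t <= T -> 0 <= alpha t) ->
  (exponent_oscillation T alpha < +oo)%E ->
  var_holder_space T alpha X ->
  0 <= a -> a <= m -> m <= b -> b <= T ->
  chen a m X A -> chen m b X B ->
  (var_holder_norm2 a m alpha A < +oo)%E ->
  (var_holder_norm2 m b alpha B < +oo)%E ->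
  (var_holder_norm2 a b alpha (glue X m A B) < +oo)%E.
Proof.
move=> alpha0 /exponent_oscillation_bound[M oscM].
move=> /var_holder_space_bound[CX CX0 XC] a0 am mb bT Ac Bc.
move=> /var_holder_norm2_finiteP[CA CA0 AC].
move=> /var_holder_norm2_finiteP[CB CB0 BC].
apply/var_holder_norm2_finiteP.
have M1 : 1 <= 1 + M ^+ 2 by rewrite lerDl sqr_ge0.
(* One summand per term of the three-term formula: the left process, the right process after the
   change of exponent, and the tensor. The sum also dominates the cases where [s] and [t] lie on the
   same side of [m]. *)
exists (CA + CB * (1 + M ^+ 2) + CX * (2 * CX)).
  by rewrite !addr_ge0 ?mulr_ge0 ?(le_trans ler01 M1).
move=> s t as_ st tb ts1.
have ts0 : 0 < t - s by rewrite subr_gt0.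
have mono (p w : R) : 0 <= p -> 0 <= w -> w <= t - s -> w `^ p <= (t - s) `^ p.
  by move=> p0 w0 wts; rewrite ge0_ler_powR ?nnegrE//; exact: ltW.
have pmin (p : R) : 0 <= p -> 0 <= Num.min (2 * p) 1.
  by move=> p0; rewrite le_min ler01 mulr_ge0.
have sT : 0 <= alpha s by apply: alpha0; apply/andP; split; lra.
have mT : 0 <= alpha m by apply: alpha0; apply/andP; split; lra.
set P := (t - s) `^ _; have P0 : 0 <= P by exact: powR_ge0.
have CX2 : 0 <= CX * (2 * CX) * P by rewrite !mulr_ge0.
have CAP : 0 <= CA * P by rewrite mulr_ge0.
have CBP : CB * P <= CB * (1 + M ^+ 2) * P.
  by rewrite ler_wpM2r// ler_peMr.
have CBP0 : 0 <= CB * P by rewrite mulr_ge0.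
rewrite !(mulrDl _ _ P).
have [tm|mt] := leP t m.
  rewrite /glue tm; have := AC s t as_ st tm ts1; rewrite -/P; lra.
have [ms|sm] := leP m s.
  rewrite (glue_right am mb Ac Bc) ?(ltW st)//.
  have := BC s t ms st tb ts1; rewrite -/P; lra.
rewrite (glue_across am mb Ac Bc) ?(ltW sm) ?(ltW mt)//.
apply: (le_trans (ler_normD _ _)); apply: lerD.
  apply: (le_trans (ler_normD _ _)); apply: lerD.
    apply: (le_trans (AC s m as_ sm (lexx m) _)); first lra.
    by apply: ler_wpM2l => //; apply: mono; [exact: pmin|lra|lra].
  apply: (le_trans (BC m t (lexx m) mt tb _)); first lra.
  rewrite -mulrA; apply: ler_wpM2l => //.
  (* First enlarge the base from [t - m] to [t - s] at the fixed exponent, then change the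
     exponent. *)
  apply: (@le_trans _ _ ((t - s) `^ Num.min (2 * alpha m) 1)).
    by apply: mono; [exact: pmin|lra|lra].
  by apply: (@powR_min_shift _ _ _ (m - s)); [lra|lra|lra|apply: oscM; lra].
have Xsm : `|increment X s m| <= CX * (t - s) `^ alpha s.
  apply: (le_trans (XC s m _ sm _ _)); [lra|lra|lra|].
  by apply: ler_wpM2l => //; apply: mono; [|lra|lra].
have Xst : `|increment X s t| <= CX * (t - s) `^ alpha s by apply: XC; lra.
(* Writing this increment as a difference of two increments based at [s] gives the exponent
   [alpha s] directly, at the price of a factor 2. *)
have Xmt : `|increment X m t| <= 2 * CX * (t - s) `^ alpha s.
  have -> : increment X m t = increment X s t - increment X s m.
    by rewrite (increment_split X s m t) addrC addKr.
  by apply: (le_trans (ler_normB _ _)); lra.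
apply: (le_trans (tensor_norm_le _ _)).
apply: (le_trans (ler_pM _ _ Xsm Xmt)) => //.
rewrite mulrACA; apply: ler_wpM2l; first by rewrite !mulr_ge0.
(* The two Hölder factors multiply to the power [2 * alpha s]; since [t - s <= 1], lowering the
   exponent to the minimum only enlarges it. *)
rewrite -expr2 -powR_mulrn ?powR_ge0// -powRrM mulrC.
by apply: ger_powR; [rewrite ts0|rewrite ge_min lexx].
Qed.

(** * Induction over the cells of the partition *)

Theorem theorem13 (R : realType) (d : nat) (T : R) (hT : 0 < T)
  (alpha : R -> R)
  (alpha_cont : {within `[0, T], continuous alpha})
  (alpha_range : forall t : R, 0 <= t <= T -> 1 / 3 < alpha t < 1)
  (alpha_osc : (exponent_oscillation T alpha < +oo)%E)
  (X : R -> 'rV[R]_d) (hX : var_holder_space T alpha X)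
  (rho : seq R) (hrho : itv_partition 0 T rho)
  (XXloc : nat -> R -> R -> 'M[R]_d)
  (XXloc_chen : forall i : nat, (i < size rho)%N ->
     chen (partition_point 0 T rho i) (partition_point 0 T rho i.+1)
       X (XXloc i))
  (XXloc_norm : forall i : nat, (i < size rho)%N ->
     (var_holder_norm2 (partition_point 0 T rho i)
        (partition_point 0 T rho i.+1) alpha (XXloc i) < +oo)%E) :
  exists XX : R -> R -> 'M[R]_d,
    [/\ chen 0 T X XX,
        (var_holder_norm2 0 T alpha XX < +oo)%E &
        var_rough_path_space T alpha (X, XX)].
Proof.
have alpha0 t : 0 <= t <= T -> 0 <= alpha t.
  by move=> /alpha_range /andP[? _]; lra.
suff: exists2 XX, chen 0 T X XX & (var_holder_norm2 0 T alpha XX < +oo)%E.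
  by move=> [XX XXc XXn]; exists XX.
pose pt := partition_point 0 T rho.
suff glued k : (k <= size rho)%N ->
    exists2 XX, chen 0 (pt k) X XX &
      (var_holder_norm2 0 (pt k) alpha XX < +oo)%E.
  have -> : T = pt (size rho); last exact: glued.
  by rewrite /pt /partition_point (itv_partition_nth_size _ hrho).
elim: k => [_|k IH kN].
  (* With no cell glued the interval is [[0, 0]]: all times coincide, and no pair [s < t] enters the
     seminorm. *)
  exists (fun _ _ => 0).
    move=> s u t s0 su ut t0.
    have -> : s = u by rewrite /pt /partition_point /= in t0; lra.
    by rewrite (tensor_increment_refl X u u t).1 /delta !subr0.
  apply/var_holder_norm2_finiteP; exists 0 => // s t s0 st t0.
  by rewrite /pt /partition_point /= in t0; lra.
have [XX XXc XXn] := IH (ltnW kN).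
have ptk0 : 0 <= pt k by apply: itv_partition_nth_ge => //; rewrite ltnS ltnW.
have ptk1 : pt k.+1 <= T by exact: itv_partition_nth_le.
have ptk : pt k <= pt k.+1.
  apply: (@nondecreasing_fun_itv_partition _ _ 0 T id) => //.
exists (glue X (pt k) XX (XXloc k)).
  by apply: glue_chen => //; exact: XXloc_chen.
by apply: (@glue_norm R d T) => //; [exact: XXloc_chen|exact: XXloc_norm].
Qed.
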